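(* The Chop Chop protocol (described in the context) satisfies total order: let $m$ and $m'$ be any two different messages; if a correct server delivers $m$ without having delivered $m'$, then no correct server delivers $m'$ before $m$.
   Context: MODEL. Message passing over authenticated point-to-point links between clients, brokers, and $3f+1$ servers (a fixed known set); no synchrony is assumed beyond what the underlying server broadcast needs. At most $f$ servers are Byzantine; any number of clients and brokers may be Byzantine, but at least one broker is correct. Cryptography is ideal: signatures and multi-signatures are unforgeable; multi-signatures of several processes on the same statement can be aggregated and verified; Merkle roots are collision-resistant, with proofs of inclusion. A directory $dir$ gives each client a unique integer identifier $id$, together with a transferable certified assignment ($id\leftrightarrow$ client) that anyone can import. Servers have access to a Server Total Order Broadcast (STOB) satisfying: no duplication (no message sent by a correct server is delivered more than once by a correct server), integrity (a message delivered by a correct server was previously broadcast by some server), validity (a message broadcast by a correct server is eventually delivered by a correct server), agreement (a message delivered by one correct server is eventually delivered by every correct server), total order (for different $m,m'$: if a correct server delivers $m$ without having delivered $m'$, no correct server delivers $m'$ before $m$). A statement is *certified* if it carries multi-signatures of $f+1$ distinct servers. An *evidence* with number $n$ is a certified statement $[\mathrm{Completion},r,n]$. INTERFACE. Clients trigger $\mathrm{Broadcast}(m)$; servers trigger $\mathrm{Deliver}(\chi,m)$ (delivery of $m$ broadcast by client $\chi$). Correct clients obey: (CR1) a client can trigger $\mathrm{Broadcast}(m')$ only once it receives the completion certificate for its previously broadcast $m$; (CR2) a client never triggers $\mathrm{Broadcast}(m)$ twice in a row with the same $m$. Correct brokers obey: (BR1) a broker can send a message (batch) to the servers only once its previously sent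 one has been delivered by STOB. CLIENT $\chi$ with identifier $id$. State: sequence-number counter $s=0$, an evidence, and for each pending message $m$ and broker $\beta$ a set $S_{m,\beta}$ of used sequence numbers. On $\mathrm{Broadcast}(m)$: mark $m$ pending and submit. Submit: choose a broker $\beta$ not yet tried for $m$, send it $[\mathrm{Submission},$ assignment of $id$, $m,s,$ signature on $[\mathrm{Message},m,s]$, stored evidence$]$, add $s$ to $S_{m,\beta}$, and start a finite timer; when it rings and $m$ is still pending, submit again. On $[\mathrm{Inclusion},m,root,proof,k,E]$ from $\beta$, where $m$ is pending and was submitted to $\beta$: if $proof$ shows that $(id,k,m)$ is a leaf under $root$, $E$ is a valid evidence, $k\le$ number of $E$, and $k\ge s$, then set $s:=k$, store $E$, add $k$ to $S_{m,\beta}$ and send $\beta$ a multi-signature on $[\mathrm{Reduction},root]$. On $[\mathrm{Completion},r,m,k,proof,n,cert]$ from $\beta$, where $cert$ certifies $[\mathrm{Completion},r,n]$: keep it as evidence if $n$ exceeds the stored number; if $m$ is pending, $k\in S_{m,\beta}$ and $proof$ shows $(id,k,m)$ is a leaf under $r$, then the sequence number is advanced by one and $m$ is no longer pending (this is receiving the completion certificate). A correct client always tags a new message with the smallest sequence number it has not yet used, i.e. the largest it has used plus one. BROKER $\beta$. Batch counter starts at 1. Import the assignment in each Submission; accept it if its signature is valid and either its sequence number is $0$ or its evidence is valid with number $\ge$ its sequence number. Accepted submissions are queued per identifier and moved into a pool containing at most one submission per identifier. When the pool is nonempty a finite timer is started; when it rings, the pool is emptied into a batch: $k$ is the maximum of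 its sequence numbers, $root$ is the Merkle root of all leaves $(id,k,m)$, and each client is sent $[\mathrm{Inclusion},m,root,proof,k,E]$ with $E$ the submitted evidence of largest number. After another finite timer, clients in the batch that have not sent a valid multi-signature on $[\mathrm{Reduction},root]$ are *stragglers*, keeping their original sequence number and signature. Let $r$ be the Merkle root of the leaves $(id,k',m)$, where $k'$ is the original sequence number for stragglers and $k'=k$ otherwise. The broker sends all servers $[\mathrm{Batch},num,ids,payloads,stragglers]$ (payloads are the pairs $(k,m)$, one per identifier; stragglers maps straggler identifiers to original sequence numbers), where $num$ is the batch counter, which is then incremented. On $[\mathrm{BatchAcquired},r,unknowns]$ from a server, it replies with $[\mathrm{Signatures},r,num,$ assignments of $unknowns$, aggregate of the multi-signatures, straggler signatures$]$. On collecting $f+1$ valid server multi-signatures on $[\mathrm{Witness},(r,\beta,num)]$ it aggregates them into a witness certificate $W$ and sends $[\mathrm{Witness},r,num,W]$ to all servers. On collecting $f+1$ valid matching completion shards (below) for the batch, it aggregates them into a certificate and sends to every client in the batch whose exception is not $\bot$ the message $[\mathrm{Completion},r',m,k'',proof,n,cert]$, where $r'$ is the completion root and $(id,k'',m)$ the client's leaf in it. SERVER. State: $batches$ (map from keys $(root,broker,number)$ to batches); for each broker $\beta$ an expected number $e_\beta=1$ and an expected root (initially empty); FIFO queue $pool$; a map $last$ from identifiers to pairs (sequence number, message), initially empty; delivery counter $c=1$; per-broker count $d_\beta$ of completed batches. (1) On $[\mathrm{Batch},num,ids,payloads,stragglers]$ from $\beta$: form the leaves $(id,k',m)$ with straggler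 sequence numbers substituted, sort the identifiers, compute the Merkle root $r$ of the leaves; if key $(r,\beta,num)\notin batches$, $num=e_\beta$, the expected root of $\beta$ is empty, identifiers are distinct and the numbers of identifiers and payloads agree, then store the batch under the key, set the expected root to $r$, and reply $[\mathrm{BatchAcquired},r,\text{identifiers unknown to } dir]$. (2) On $[\mathrm{Signatures},r,num,\dots]$ from $\beta$: import the assignments; require that $r$ is the expected root of $\beta$, $num=e_\beta$, and all identifiers of the batch stored under $(r,\beta,num)$ are known. Check that exactly the stragglers come with individual signatures, each valid on $[\mathrm{Message},m,\text{straggler number}]$, and that the aggregate multi-signature is valid for all other identifiers on $[\mathrm{Reduction},\rho]$, with $\rho$ the Merkle root of the leaves built from $ids$ and $payloads$ (without straggler substitution). If so, send $\beta$ a multi-signature on $[\mathrm{Witness},(r,\beta,num)]$. (3) On $[\mathrm{Witness},r,num,W]$ from $\beta$ with $r$ the expected root, $num=e_\beta$ and $W$ certifying $[\mathrm{Witness},(r,\beta,num)]$: STOB-broadcast $(\beta,r,W)$. (4) On STOB-delivery of $(\beta,r,W)$: let $key=(r,\beta,e_\beta)$; ignore unless $W$ certifies $[\mathrm{Witness},key]$. Otherwise increment $e_\beta$; if the expected root of $\beta$ is not $r$, send $[\mathrm{RequestBatch},key]$ to all servers; push $key$ into $pool$; remove $r$ from the expected root of $\beta$. (5) On $[\mathrm{RequestBatch},key]$ with $key\in batches$: reply with the stored batch and its assignments. On receiving such a reply for $key\in pool$, $key\notin batches$: import the assignments, sort the identifiers, recompute the root (with straggler substitution) and store the batch under $key$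 if all identifiers are known and the root equals that of $key$. (6) When the head $key=(r,\beta,num)$ of $pool$ is in $batches$: pop it and complete the batch. For each identifier in sorted order, with message $m$ and sequence number $q$ (straggler number if a straggler, payload number otherwise) and $last[id]=(q',m')$: if $q<q'$, the exception and the completion leaf of $id$ are $\bot$; else if $m=m'$, the exception is $q'$ and the leaf is $(id,q',m')$; else if $q>q'$ and $m\ne m'$, set $last[id]:=(q,m)$, take the leaf $(id,q,m)$, and trigger $\mathrm{Deliver}(dir[id],m)$. In no other case is anything delivered. Send $\beta$ a completion shard: a multi-signature on $[\mathrm{Completion},\text{Merkle root of the completion leaves},c]$ together with the exceptions. Then increment $c$ and $d_\beta$ and send $[\mathrm{Collection},key]$ to all servers. (7) On $[\mathrm{Collection},(r,\beta,num)]$ with $num\le d_\beta$: reply $[\mathrm{CollectionAccept},key]$. A server that has completed $key$ and received $[\mathrm{CollectionAccept},key]$ from all $3f+1$ servers deletes $key$ from $batches$. *)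

(* Defs.v *)
From Stdlib Require List.
From HB Require Import structures.
From mathcomp Require Import all_boot all_order all_algebra finmap.

Set Implicit Arguments.
Unset Strict Implicit.
Unset Printing Implicit Defensive.

(* Processes, identifiers, ideal Merkle trees and the (static) fault pattern.
   A leaf [(id, k, m)] is a message [m] with sequence number [k] of the client
   with identifier [id]; [None] is the leaf bottom.  A pair [(id, c)]
   is an authentic certified assignment exactly when [ident c = id]. *)
Record environment := Environment {
  nfault : nat;
  client : eqType;
  broker : eqType;
  msg : eqType;
  root : eqType;
  mproof : Type;
  merkle : seq (option (int * nat * msg)) -> root;
  prove : seq (option (int * nat * msg)) -> option (int * nat * msg) -> mproof;
  verify : root -> option (int * nat * msg) -> mproof -> bool;
  merkle_inj : injective merkle;
  verify_sound : forall ls x pf, verify (merkle ls) x pf -> x \in ls;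
  verify_complete : forall ls x, x \in ls -> verify (merkle ls) x (prove ls x);
  ident : client -> int;
  ident_inj : injective ident;
  correct_client : pred client;
  correct_broker : pred broker;
  correct_server : {set 'I_(3 * nfault).+1};
  few_faulty_servers : #|~: correct_server| <= nfault;
  some_correct_broker : exists b, correct_broker b
}.

Definition upd (A : eqType) (B : Type) (g : A -> B) (a : A) (b : B) : A -> B :=
  [eta g with a |-> b].

(* [x] is delivered at a point of the log [l] where [y] has not been
   delivered. *)
Definition delivers_without (T : Type) (x y : T) (l : seq T) : Prop :=
  exists l1 l2, l = l1 ++ x :: l2 /\ ~ List.In y l1.

(* [log t i] is the sequence of messages delivered by [i] up to time [t]. *)
Definition total_order (I T : Type) (correct : I -> Prop)
    (log : nat -> I -> seq T) : Prop :=
  forall m m' : T, m <> m' ->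
  forall i, correct i -> (exists t, delivers_without m m' (log t i)) ->
  forall j, correct j -> ~ (exists t, delivers_without m' m (log t j)).

Section Protocol.
Context {E : environment}.

Local Notation client := (client E).
Local Notation broker := (broker E).
Local Notation msg := (msg E).
Local Notation root := (root E).
Local Notation mproof := (mproof E).
Local Notation f := (nfault E).

Definition server : finType := 'I_(3 * f).+1.

Definition leaf : eqType := (int * nat * msg)%type.

Definition key : eqType := (root * broker * nat)%type.

Inductive proc := Client of client | Broker of broker | Server of server.

Definition proc_code (p : proc) : client + (broker + server) :=
  match p with
  | Client c => inl c | Broker b => inr (inl b) | Server i => inr (inr i)
  end.
Definition proc_decode (x : client + (broker + server)) : proc :=
  match x with
  | inl c => Client c | inr (inl b) => Broker b | inr (inr i) => Server i
  end.
Lemma proc_codeK : cancel proc_code proc_decode.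
Proof. by case. Qed.
HB.instance Definition _ := Equality.copy proc (can_type proc_codeK).

Definition correct (p : proc) : bool :=
  match p with
  | Client c => correct_client c
  | Broker b => correct_broker b
  | Server i => i \in correct_server E
  end.

Inductive statement :=
| SMessage of msg & nat
| SReduction of root
| SWitness of key
| SCompletion of root & nat.

Definition st_code (s : statement) : (msg * nat) + (root + (key + (root * nat))) :=
  match s with
  | SMessage m k => inl (m, k)
  | SReduction r => inr (inl r)
  | SWitness x => inr (inr (inl x))
  | SCompletion r n => inr (inr (inr (r, n)))
  end.
Definition st_decode (x : (msg * nat) + (root + (key + (root * nat)))) :=
  match x with
  | inl (m, k) => SMessage m k
  | inr (inl r) => SReduction r
  | inr (inr (inl x)) => SWitness x
  | inr (inr (inr (r, n))) => SCompletion r n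
  end.
Lemma st_codeK : cancel st_code st_decode.
Proof. by case. Qed.
HB.instance Definition _ := Equality.copy statement (can_type st_codeK).

(* Ideal (multi-)signatures: the signed statement and the signers.  A plain
   signature has one signer.  Unforgeability is the condition [derivable]
   imposed below on everything that faulty processes send or STOB-broadcast:
   they may use any signature already made by a correct process. *)
Definition msig : eqType := (statement * seq proc)%type.

Definition certifies (W : msig) (s : statement) : bool :=
  (W.1 == s) && (f < #|[set i : server | Server i \in W.2]|).

Definition stobmsg : eqType := (broker * root * msig)%type.

Definition evidence : Type := (root * nat * msig)%type.
Definition valid_evidence (e : evidence) : bool :=
  certifies e.2 (SCompletion e.1.1 e.1.2).
(* Valid evidences have numbers >= 1, so 0 stands for "no evidence". *)
Definition evidence_num (e : option evidence) : nat :=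
  if e is Some e then e.1.2 else 0.

Definition directory := int -> option client.
Definition sound (d : directory) : Prop :=
  forall id c, d id = Some c -> ident c = id.
Definition assignment : Type := (int * client)%type.
Definition import (d : directory) (a : seq assignment) : directory :=
  foldl (fun d x => if ident x.2 == x.1 then upd d x.1 (Some x.2) else d)
        d a.
Definition assignments (d : directory) (ids : seq int) : seq assignment :=
  pmap (fun id => omap (pair id) (d id)) ids.

Record batch := MkBatch {
  ids : seq int;
  payloads : seq (nat * msg);
  stragglers : {fmap int -> nat}
}.

Definition sort_leaves : seq leaf -> seq leaf :=
  sort (fun x y : leaf => (x.1.1 <= y.1.1)%R).
Definition plain_leaves (b : batch) : seq leaf :=
  sort_leaves [seq (x.1, x.2.1, x.2.2) | x <- zip (ids b) (payloads b)].
Definition leaves (b : batch) : seq leaf :=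
  sort_leaves [seq (x.1, odflt x.2.1 (stragglers b).[? x.1]%fmap, x.2.2)
              | x <- zip (ids b) (payloads b)].
Definition root_of (ls : seq leaf) : root := merkle (map Some ls).

(* [Some None] is the exception bottom, [Some (Some q)] the exception [q], and
   an unbound identifier has no exception. *)
Definition exceptions : choiceType := {fmap int -> option nat}.
Definition completion_leaf (exc : exceptions) (l : leaf) : option leaf :=
  match (exc.[? l.1.1])%fmap with
  | None => Some l
  | Some None => None
  | Some (Some q) => Some (l.1.1, q, l.2)
  end.

Inductive message :=
| MSubmission of assignment & msg & nat & msig & option evidence
| MInclusion of msg & root & mproof & nat & option evidence
| MReduction of msig
| MBatch of nat & batch
| MBatchAcquired of root & seq int
| MSignatures of root & nat & seq assignment & msig & {fmap int -> msig}
| MWitnessShard of msig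
| MWitness of root & nat & msig
| MCompletionShard of key & msig & exceptions
| MCompletion of root & msg & nat & mproof & nat & msig
| MRequestBatch of key
| MBatchReply of key & batch & seq assignment
| MCollection of key
| MCollectionAccept of key.

Definition msigs (x : message) : seq msig :=
  let of_evidence (e : option evidence) := if e is Some e then [:: e.2] else [::] in
  match x with
  | MSubmission _ _ _ sg e => sg :: of_evidence e
  | MInclusion _ _ _ _ e => of_evidence e
  | MReduction sg => [:: sg]
  | MSignatures _ _ _ agg sgs =>
      agg :: pmap (fun id => (sgs.[? id])%fmap) (enum_fset (domf sgs))
  | MWitnessShard sg => [:: sg]
  | MWitness _ _ W => [:: W]
  | MCompletionShard _ sg _ => [:: sg]
  | MCompletion _ _ _ _ _ W => [:: W]
  | _ => [::]
  end.

Definition outbox : Type := seq (proc * message).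
Definition to_servers (x : message) : outbox :=
  [seq (Server i, x) | i <- enum server].

Record cstate := CState {
  c_seq : nat;
  c_evidence : option evidence;
  c_last : option msg;                 (* last message broadcast *)
  c_pending : seq msg;
  c_tried : msg -> seq broker;
  c_used : msg * broker -> seq nat;    (* the sets S_{m, b} *)
  c_timers : seq msg                   (* running submission timers *)
}.

Definition init_client : cstate :=
  CState 0 None None [::] (fun _ => [::]) (fun _ => [::]) [::].

(* A message leaves [c_pending] when its completion certificate is received; the
   same message is never broadcast twice in a row. *)
Definition may_broadcast (s : cstate) (m : msg) : bool :=
  if c_last s is Some m0 then (m0 \notin c_pending s) && (m0 != m) else true.

Definition client_submit (c : client) (s : cstate) (m : msg) (b : broker)
    : cstate * outbox :=
  let 'CState k ev lst pend tried used tm := s in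
  (CState k ev lst pend (upd tried m (b :: tried m))
     (upd used (m, b) (k :: used (m, b))) (m :: tm),
   [:: (Broker b,
        MSubmission (ident c, c) m k (SMessage m k, [:: Client c]) ev)]).

(* The tried brokers and the sets S_{m, b} belong to a pending message, hence
   they are reset when [m] is broadcast afresh. *)
Definition client_broadcast (c : client) (s : cstate) (m : msg) (b : broker) :=
  let 'CState k ev lst pend tried used tm := s in
  client_submit c
    (CState k ev (Some m) (m :: pend) (upd tried m [::])
       (fun x => if x.1 == m then [::] else used x) tm) m b.

Definition client_ring (s : cstate) (m : msg) : cstate :=
  let 'CState k ev lst pend tried used tm := s in
  CState k ev lst pend tried used (rem m tm).

Definition client_recv (c : client) (s : cstate) (src : proc) (x : message)
    : cstate * outbox :=
  let 'CState sn ev lst pend tried used tm := s in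
  match src, x with
  | Broker b, MInclusion m r pf k (Some e) =>
      if [&& m \in pend, b \in tried m, verify r (Some (ident c, k, m)) pf,
             valid_evidence e, k <= evidence_num (Some e) & sn <= k]
      then (CState k (Some e) lst pend tried
              (upd used (m, b) (k :: used (m, b))) tm,
            [:: (Broker b, MReduction (SReduction r, [:: Client c]))])
      else (s, [::])
  | Broker b, MCompletion r m k pf n W =>
      if certifies W (SCompletion r n) then
        let ev' := if evidence_num ev < n then Some (r, n, W) else ev in
        if [&& m \in pend, k \in used (m, b) & verify r (Some (ident c, k, m)) pf]
        then (CState sn.+1 ev' lst (filter (predC1 m) pend) tried used tm, [::])
        else (CState sn ev' lst pend tried used tm, [::])
      else (s, [::])
  | _, _ => (s, [::])
  end.

Record submission := MkSub {
  sub_client : client;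
  sub_msg : msg;
  sub_seq : nat;
  sub_sig : msig;
  sub_evidence : option evidence
}.
Definition sub_id (u : submission) : int := ident (sub_client u).

(* A batch in its reduction phase. *)
Record obatch := MkOpen {
  o_subs : seq submission;
  o_max : nat;
  o_root : root;
  o_reduced : seq client
}.

(* A batch sent to the servers. *)
Record sbatch := MkSent {
  s_num : nat;
  s_root : root;
  s_batch : batch;
  s_open : obatch;
  s_witness : {set server};
  s_shards : seq (server * (exceptions * nat));
  s_done : bool
}.

Record bstate := BState {
  b_num : nat;
  b_dir : directory;
  b_queue : int -> seq submission;
  b_pool : seq submission;
  b_open : seq obatch;
  b_sent : seq sbatch;
  b_last : option key                  (* last batch sent *)
}.

Definition init_broker (d : directory) : bstate :=
  BState 1 d (fun _ => [::]) [::] [::] [::] None.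

Definition best_evidence (us : seq submission) : option evidence :=
  foldl (fun acc (e : option evidence) =>
           if e is Some e' then
             if valid_evidence e' && (evidence_num acc < evidence_num e)
             then e else acc
           else acc)
        None (map sub_evidence us).

Definition broker_pool (s : bstate) (id : int) (u : submission)
    (us : seq submission) : bstate :=
  let 'BState num d q p op sn lst := s in
  BState num d (upd q id us) (rcons p u) op sn lst.

Definition broker_flush (s : bstate) : bstate * outbox :=
  let 'BState num d q us op sn lst := s in
  let k := \max_(u <- us) sub_seq u in
  let ls := sort_leaves [seq (sub_id u, k, sub_msg u) | u <- us] in
  let r := root_of ls in
  (BState num d q [::] (rcons op (MkOpen us k r [::])) sn lst,
   [seq (Client (sub_client u),
         MInclusion (sub_msg u) r
           (prove (map Some ls) (Some (sub_id u, k, sub_msg u))) k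
           (best_evidence us))
   | u <- us]).

Definition straggling (o : obatch) : seq submission :=
  [seq u <- o_subs o | sub_client u \notin o_reduced o].

Definition broker_close (b : broker) (s : bstate) (op1 : seq obatch)
    (o : obatch) (op2 : seq obatch) : bstate * outbox :=
  let 'BState num d q p _ sn lst := s in
  let bt := MkBatch (map sub_id (o_subs o))
              [seq (o_max o, sub_msg u) | u <- o_subs o]
              (foldr (fun u (g : {fmap int -> nat}) => g.[sub_id u <- sub_seq u])%fmap
                     fmap0 (straggling o)) in
  let r := root_of (leaves bt) in
  (BState num.+1 d q p (op1 ++ op2)
     (rcons sn (MkSent num r bt o set0 [::] false)) (Some (r, b, num)),
   to_servers (MBatch num bt)).

(* [f + 1] distinct servers: the threshold is crossed by the shard that makes
   the set of signers reach that size. *)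
Definition on_witness_shard (b : broker) (i : server) (x : sbatch)
    : sbatch * outbox :=
  let 'MkSent num r bt o w sh dn := x in
  let w' := i |: w in
  (MkSent num r bt o w' sh dn,
   if (i \notin w) && (#|w'| == f.+1) then
     to_servers (MWitness r num (SWitness (r, b, num), map Server (enum w')))
   else [::]).

Definition on_completion_shard (d : directory) (i : server) (rc : root)
    (n : nat) (exc : exceptions) (x : sbatch) : sbatch * outbox :=
  let 'MkSent num r bt o w sh dn := x in
  let cls := map (completion_leaf exc) (leaves bt) in
  if rc != merkle cls then (x, [::]) else
  let sh' := (i, (exc, n)) :: sh in
  let matching := [set j : server | (j, (exc, n)) \in sh'] in
  if ~~ dn && (f < #|matching|) then
    let W : msig := (SCompletion rc n, map Server (enum matching)) in
    (MkSent num r bt o w sh' true,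
     pmap (fun l : option leaf =>
             if l is Some (id, k, m) then
               omap (fun c => (Client c, MCompletion rc m k (prove cls l) n W))
                    (d id)
             else None) cls)
  else (MkSent num r bt o w sh' dn, [::]).

Definition update_sent (s : bstate) (p : pred sbatch)
    (g : sbatch -> sbatch * outbox) : bstate * outbox :=
  let 'BState num d q po op sn lst := s in
  (BState num d q po op [seq if p x then (g x).1 else x | x <- sn] lst,
   flatten [seq if p x then (g x).2 else [::] | x <- sn]).

Definition broker_recv (b : broker) (s : bstate) (src : proc) (x : message)
    : bstate * outbox :=
  let 'BState num d q po op sn lst := s in
  match src, x with
  | Client _, MSubmission a m k sg ev =>
      let s' := BState num (import d [:: a]) q po op sn lst in
      let u := MkSub a.2 m k sg ev in
      let ok_evidence :=
        if ev is Some e then valid_evidence e && (k <= evidence_num ev)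
        else false in
      if [&& ident a.2 == a.1, sg == (SMessage m k, [:: Client a.2])
           & (k == 0) || ok_evidence]
      then (BState num (import d [:: a]) (upd q a.1 (rcons (q a.1) u))
              po op sn lst, [::])
      else (s', [::])
  | Client c, MReduction sg =>
      let mark o :=
        if (sg == (SReduction (o_root o), [:: Client c]))
           && (c \in map sub_client (o_subs o))
        then MkOpen (o_subs o) (o_max o) (o_root o) (c :: o_reduced o)
        else o in
      (BState num d q po (map mark op) sn lst, [::])
  | Server i, MBatchAcquired r unknowns =>
      (s, [seq (src,
            MSignatures r (s_num y) (assignments d unknowns)
              (SReduction (o_root (s_open y)),
               [seq Client (sub_client u) | u <- o_subs (s_open y)
                  & sub_client u \in o_reduced (s_open y)])
              (foldr (fun u (g : {fmap int -> msig}) =>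
                        g.[sub_id u <- sub_sig u])%fmap
                     fmap0 (straggling (s_open y))))
          | y <- sn & s_root y == r])
  | Server i, MWitnessShard sg =>
      update_sent s
        (fun y => sg == (SWitness (s_root y, b, s_num y), [:: Server i]))
        (on_witness_shard b i)
  | Server i, MCompletionShard (r, b', num') (SCompletion rc n, ps) exc =>
      update_sent s
        (fun y => [&& b' == b, s_num y == num', s_root y == r
                    & ps == [:: Server i]])
        (on_completion_shard d i rc n exc)
  | _, _ => (s, [::])
  end.

Record sstate := SState {
  batches : key -> option batch;
  expected_num : broker -> nat;
  expected_root : broker -> option root;
  pool : seq key;
  last_of : int -> option (nat * msg);
  counter : nat;
  ncompleted : broker -> nat;
  s_dir : directory;
  completed : seq key;
  accepts : key -> {set server};
  stob_log : seq stobmsg;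
  (* The events Deliver(dir[id], m), oldest first; [None] when [id] is not in
     the local directory. *)
  delivered : seq (option client * msg)
}.

Definition init_server (d : directory) : sstate :=
  SState (fun _ => None) (fun _ => 1) (fun _ => None) [::] (fun _ => None) 1
         (fun _ => 0) d [::] (fun _ => set0) [::] [::].

(* Individual signatures of exactly the stragglers, on their original numbers,
   and the aggregate for everybody else. *)
Definition signatures_ok (d : directory) (bt : batch) (agg : msig)
    (sgs : {fmap int -> msig}) : bool :=
  [&& domf sgs == domf (stragglers bt),
      all (mem (ids bt)) (enum_fset (domf (stragglers bt))),
      agg.1 == SReduction (root_of (plain_leaves bt))
    & all (fun l : leaf =>
             if d l.1.1 is Some c then
               if l.1.1 \in domf (stragglers bt)
               then sgs.[? l.1.1]%fmap == Some (SMessage l.2 l.1.2, [:: Client c])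
               else Client c \in agg.2
             else false) (leaves bt)].

Record completion_acc := CAcc {
  a_last : int -> option (nat * msg);
  a_exc : exceptions;
  a_leaves : seq (option leaf);
  a_delivered : seq (int * msg)
}.

(* Nothing is known of [id] while [last id] is empty, so its message is fresh.
   A different message with the same sequence number as the last one delivered
   is neither delivered nor certified. *)
Definition complete_leaf (acc : completion_acc) (l : leaf) : completion_acc :=
  let 'CAcc last exc cls dl := acc in
  let: (id, q, m) := l in
  let deliver := CAcc (upd last id (Some (q, m))) exc
                      (rcons cls (Some (id, q, m))) (rcons dl (id, m)) in
  let reject := CAcc last exc.[id <- None]%fmap (rcons cls None) dl in
  if last id is Some (q', m') then
    if q < q' then reject
    else if m == m' then
      CAcc last exc.[id <- Some q']%fmap (rcons cls (Some (id, q', m'))) dl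
    else if q' < q then deliver
    else reject
  else deliver.

(* [k] is the head of the pool, [pl] the rest of it and [bt] the batch stored
   under [k]. *)
Definition server_complete (i : server) (s : sstate) (k : key) (pl : seq key)
    (bt : batch) : sstate * outbox :=
  let 'SState bs en er _ last c nc d co ac sl dl := s in
  let b := k.1.2 in
  let acc := foldl complete_leaf (CAcc last fmap0 [::] [::]) (leaves bt) in
  (SState bs en er pl (a_last acc) c.+1 (upd nc b (nc b).+1) d
     (k :: co) ac sl (dl ++ [seq (d x.1, x.2) | x <- a_delivered acc]),
   (Broker b,
    MCompletionShard k (SCompletion (merkle (a_leaves acc)) c, [:: Server i])
      (a_exc acc)) :: to_servers (MCollection k)).

Definition server_stob_deliver (s : sstate) (x : stobmsg) : sstate * outbox :=
  let 'SState bs en er pl last c nc d co ac sl dl := s in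
  let: (b, r, W) := x in
  let k : key := (r, b, en b) in
  let sl' := rcons sl x in
  if certifies W (SWitness k) then
    (SState bs (upd en b (en b).+1)
       (if er b == Some r then upd er b None else er)
       (rcons pl k) last c nc d co ac sl' dl,
     if er b == Some r then [::] else to_servers (MRequestBatch k))
  else (SState bs en er pl last c nc d co ac sl' dl, [::]).

(* The last component is the list of messages to STOB-broadcast.  A request is
   answered to whoever sent it. *)
Definition server_recv (i : server) (s : sstate) (src : proc) (x : message)
    : sstate * outbox * seq stobmsg :=
  let 'SState bs en er pl last c nc d co ac sl dl := s in
  match src, x with
  | Broker b, MBatch num bt =>
      let r := root_of (leaves bt) in
      let k : key := (r, b, num) in
      if [&& ~~ bs k, num == en b, er b == None, uniq (ids bt)
           & size (ids bt) == size (payloads bt)]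
      then (SState (upd bs k (Some bt)) en (upd er b (Some r))
              pl last c nc d co ac sl dl,
            [:: (src, MBatchAcquired r [seq id <- ids bt | ~~ d id])], [::])
      else (s, [::], [::])
  | Broker b, MSignatures r num a agg sgs =>
      let d' := import d a in
      let s' := SState bs en er pl last c nc d' co ac sl dl in
      let ok :=
        if bs (r, b, num) is Some bt
        then all (fun id => isSome (d' id)) (ids bt) && signatures_ok d' bt agg sgs
        else false in
      if [&& er b == Some r, num == en b & ok]
      then (s', [:: (src, MWitnessShard (SWitness (r, b, num), [:: Server i]))],
            [::])
      else (s', [::], [::])
  | Broker b, MWitness r num W =>
      if [&& er b == Some r, num == en b & certifies W (SWitness (r, b, num))]
      then (s, [::], [:: (b, r, W)])
      else (s, [::], [::])
  | _, MRequestBatch k =>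
      if bs k is Some bt
      then (s, [:: (src, MBatchReply k bt (assignments d (ids bt)))], [::])
      else (s, [::], [::])
  | _, MBatchReply k bt a =>
      if (k \in pl) && ~~ bs k then
        let d' := import d a in
        let bs' :=
          if all (fun id => isSome (d' id)) (ids bt)
             && (root_of (leaves bt) == k.1.1)
          then upd bs k (Some bt) else bs in
        (SState bs' en er pl last c nc d' co ac sl dl, [::], [::])
      else (s, [::], [::])
  | _, MCollection k =>
      if k.2 <= nc k.1.2 then (s, [:: (src, MCollectionAccept k)], [::])
      else (s, [::], [::])
  | Server j, MCollectionAccept k =>
      let ac' := upd ac k (j |: ac k) in
      let bs' := if (k \in co) && (j |: ac k == [set: server])
                 then upd bs k None else bs in
      (SState bs' en er pl last c nc d co ac' sl dl, [::], [::])
  | _, _ => (s, [::], [::])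
  end.

Definition packet : Type := (proc * proc * message)%type.

(* Links are authenticated: a packet [(src, dst, x)] carries its true source.
   [net] is the list of packets in flight, [signed] lists the pairs of a process
   and a statement that it has signed so far, [stob_sent] the STOB-broadcasts. *)
Record gstate := GState {
  clients : client -> cstate;
  brokers : broker -> bstate;
  servers : server -> sstate;
  net : seq packet;
  signed : seq (proc * statement);
  stob_sent : seq (server * stobmsg)
}.

Definition emit (p : proc) (o : outbox) (G : gstate) : gstate :=
  GState (clients G) (brokers G) (servers G)
    (net G ++ [seq (p, x.1, x.2) | x <- o])
    (signed G ++ [seq (p, sg.1) | sg <- flatten [seq msigs x.2 | x <- o]
                                & p \in sg.2])
    (stob_sent G).
Definition stob_emit (i : server) (xs : seq stobmsg) (G : gstate) : gstate :=
  GState (clients G) (brokers G) (servers G) (net G) (signed G)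
    (stob_sent G ++ [seq (i, x) | x <- xs]).
Definition set_net (n : seq packet) (G : gstate) : gstate :=
  GState (clients G) (brokers G) (servers G) n (signed G) (stob_sent G).
Definition set_client (c : client) (s : cstate) (G : gstate) : gstate :=
  GState (upd (clients G) c s) (brokers G) (servers G) (net G) (signed G)
    (stob_sent G).
Definition set_broker (b : broker) (s : bstate) (G : gstate) : gstate :=
  GState (clients G) (upd (brokers G) b s) (servers G) (net G) (signed G)
    (stob_sent G).
Definition set_server (i : server) (s : sstate) (G : gstate) : gstate :=
  GState (clients G) (brokers G) (upd (servers G) i s) (net G) (signed G)
    (stob_sent G).

Definition derivable (G : gstate) (sg : msig) : bool :=
  all (fun p => correct p ==> ((p, sg.1) \in signed G)) sg.2.

(* The batch previously sent by the broker has been delivered by STOB. *)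
Definition previous_delivered (G : gstate) (s : bstate) : Prop :=
  if b_last s is Some (r, b, num) then
    exists i W, [/\ i \in correct_server E,
      (b, r, W) \in stob_log (servers G i) & certifies W (SWitness (r, b, num))]
  else True.

Inductive label :=
| Idle
| Receive of packet
| ClientBroadcast of client & msg
| ClientTimer of client & msg
| BrokerPool of broker & int
| BrokerFlush of broker
| BrokerClose of broker & nat
| ServerComplete of server
| StobDeliver of server & stobmsg
| FaultySend of packet
| FaultyStob of server & stobmsg.

Inductive step : label -> gstate -> gstate -> Prop :=
| StepIdle G : step Idle G G
| StepReceiveFaulty G n1 n2 src dst x :
    ~~ correct dst -> net G = n1 ++ (src, dst, x) :: n2 ->
    step (Receive (src, dst, x)) G (set_net (n1 ++ n2) G)
| StepReceiveClient G n1 n2 src c x s o :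
    correct_client c -> net G = n1 ++ (src, Client c, x) :: n2 ->
    client_recv c (clients G c) src x = (s, o) ->
    step (Receive (src, Client c, x)) G
      (emit (Client c) o (set_client c s (set_net (n1 ++ n2) G)))
| StepReceiveBroker G n1 n2 src b x s o :
    correct_broker b -> net G = n1 ++ (src, Broker b, x) :: n2 ->
    broker_recv b (brokers G b) src x = (s, o) ->
    step (Receive (src, Broker b, x)) G
      (emit (Broker b) o (set_broker b s (set_net (n1 ++ n2) G)))
| StepReceiveServer G n1 n2 src i x s o xs :
    i \in correct_server E -> net G = n1 ++ (src, Server i, x) :: n2 ->
    server_recv i (servers G i) src x = (s, o, xs) ->
    step (Receive (src, Server i, x)) G
      (stob_emit i xs (emit (Server i) o (set_server i s (set_net (n1 ++ n2) G))))
| StepClientBroadcast G c m b s o :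
    correct_client c -> may_broadcast (clients G c) m ->
    client_broadcast c (clients G c) m b = (s, o) ->
    step (ClientBroadcast c m) G (emit (Client c) o (set_client c s G))
| StepClientResubmit G c m b s o :
    correct_client c -> m \in c_timers (clients G c) ->
    m \in c_pending (clients G c) -> b \notin c_tried (clients G c) m ->
    client_submit c (client_ring (clients G c) m) m b = (s, o) ->
    step (ClientTimer c m) G (emit (Client c) o (set_client c s G))
| StepClientGiveUp G c m :
    correct_client c -> m \in c_timers (clients G c) ->
    (m \in c_pending (clients G c) -> forall b, b \in c_tried (clients G c) m) ->
    step (ClientTimer c m) G (set_client c (client_ring (clients G c) m) G)
| StepBrokerPool G b id u us :
    correct_broker b -> b_queue (brokers G b) id = u :: us ->
    id \notin map sub_id (b_pool (brokers G b)) ->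
    step (BrokerPool b id) G
      (set_broker b (broker_pool (brokers G b) id u us) G)
| StepBrokerFlush G b s o :
    correct_broker b -> 0 < size (b_pool (brokers G b)) ->
    broker_flush (brokers G b) = (s, o) ->
    step (BrokerFlush b) G (emit (Broker b) o (set_broker b s G))
| StepBrokerClose G b op1 ob op2 s o :
    correct_broker b -> b_open (brokers G b) = op1 ++ ob :: op2 ->
    previous_delivered G (brokers G b) ->
    broker_close b (brokers G b) op1 ob op2 = (s, o) ->
    step (BrokerClose b (size op1)) G (emit (Broker b) o (set_broker b s G))
| StepServerComplete G i k pl bt s o :
    i \in correct_server E -> pool (servers G i) = k :: pl ->
    batches (servers G i) k = Some bt ->
    server_complete i (servers G i) k pl bt = (s, o) ->
    step (ServerComplete i) G (emit (Server i) o (set_server i s G))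
| StepStobDeliver G i x s o :
    i \in correct_server E ->
    server_stob_deliver (servers G i) x = (s, o) ->
    step (StobDeliver i x) G (emit (Server i) o (set_server i s G))
| StepFaultySend G src dst x :
    ~~ correct src -> all (derivable G) (msigs x) ->
    step (FaultySend (src, dst, x)) G (emit src [:: (dst, x)] G)
| StepFaultyStob G i (x : stobmsg) :
    i \notin correct_server E -> derivable G x.2 ->
    step (FaultyStob i x) G (stob_emit i [:: x] G).

Definition initial (G : gstate) : Prop :=
  [/\ clients G = fun _ => init_client,
      forall b, exists2 d, sound d & brokers G b = init_broker d,
      forall i, exists2 d, sound d & servers G i = init_server d
    & [/\ net G = [::], signed G = [::] & stob_sent G = [::]]].

(* Actions that cannot be postponed forever: reception over links between
   correct processes, expiration of timers, and local steps. *)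
Definition obligatory (l : label) : bool :=
  match l with
  | Receive (src, dst, _) => correct src && correct dst
  | ClientTimer _ _ | BrokerPool _ _ | BrokerFlush _ | BrokerClose _ _
  | ServerComplete _ => true
  | _ => false
  end.

Record execution (lab : nat -> label) (st : nat -> gstate) : Prop := Execution {
  exec_initial : initial (st 0);
  exec_step : forall t, step (lab t) (st t) (st t.+1);
  exec_fair : forall l t, obligatory l ->
    (forall t', t <= t' -> exists G, step l (st t') G) ->
    exists2 t', t <= t' & lab t' = l
}.

Record stob_properties (st : nat -> gstate) : Prop := StobProperties {
  stob_no_duplication : forall i x t t' j,
    i \in correct_server E -> (i, x) \in stob_sent (st t) ->
    j \in correct_server E -> count_mem x (stob_log (servers (st t') j)) <= 1;
  stob_integrity : forall j x t,
    j \in correct_server E -> x \in stob_log (servers (st t) j) ->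
    exists i, (i, x) \in stob_sent (st t);
  stob_validity : forall i x t,
    i \in correct_server E -> (i, x) \in stob_sent (st t) ->
    exists j t', j \in correct_server E /\ x \in stob_log (servers (st t') j);
  stob_agreement : forall i j x t,
    i \in correct_server E -> j \in correct_server E ->
    x \in stob_log (servers (st t) i) ->
    exists t', x \in stob_log (servers (st t') j);
  stob_total_order :
    total_order (fun i => i \in correct_server E)
                (fun t i => stob_log (servers (st t) i))
}.

Definition delivered_messages (st : nat -> gstate) (t : nat) (i : server)
    : seq msg :=
  [seq x.2 | x <- delivered (servers (st t) i)].

End Protocol.

Arguments gstate : clear implicits.
Arguments label : clear implicits.

(* Submission.v *)
(** The batches that a server completes are determined by the log of its STOB
  deliveries, in which a key is accepted when its witness is certified and its
  number is the next one of its broker.  A witness has a correct signer, which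
  signed only after the previous batches of the broker were delivered to it, and
  hence with a log lacking that witness; by total order of STOB, the witness
  then reaches no correct server before its turn.  So acceptance depends only on
  the order of first deliveries (a message STOB-broadcast by faulty servers only
  may be delivered twice), and the accepted keys of two correct servers are
  nested: one sequence is a prefix of the other.  As Merkle roots determine the
  leaves, so are the sequences of delivered messages. *)

Require Import Defs.
From Stdlib Require List.
From mathcomp Require Import all_boot ssrint finmap.

Set Implicit Arguments.
Unset Strict Implicit.
Unset Printing Implicit Defensive.

(** * Prefix-comparable sequences and the order of first occurrences *)

Section Nested.
Variable T : eqType.
Implicit Types s l : seq T.

Definition nested s1 s2 := prefix s1 s2 || prefix s2 s1.

Lemma nestedC s1 s2 : nested s1 s2 = nested s2 s1.
Proof. exact: orbC. Qed.

(** Stripping equal heads stops at a disagreement, where [c] is the longest common prefix; if either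
    list ended first, it would be a prefix of the other. *)
Lemma not_nested s1 s2 : ~~ nested s1 s2 ->
  exists c x1 x2, [/\ x1 != x2, prefix (rcons c x1) s1 & prefix (rcons c x2) s2].
Proof.
rewrite /nested; elim: s1 s2 => [|x s1 IH] [|y s2] //=.
case: (eqVneq x y) => [-> /=|xy _].
  case/IH=> c [x1 [x2 [ne p1 p2]]].
  by exists (y :: c), x1, x2; rewrite /= eqxx; split.
by exists [::], x, y; rewrite /= !eqxx !prefix0s.
Qed.

Lemma prefix_nested s1 s2 l : prefix s1 l -> prefix s2 l -> nested s1 s2.
Proof.
wlog le12 : s1 s2 / size s1 <= size s2 => [hw p1 p2|].
  have [le|/ltnW le] := leqP (size s1) (size s2); first exact: hw.
  by rewrite nestedC; exact: hw.
rewrite /nested !prefixE => /eqP p1 /eqP p2.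
by rewrite -{1}p2 take_takel // p1 eqxx.
Qed.

(** Both [s1] and [s2] are prefixes of the longer of [l1] and [l2]. *)
Lemma nested_prefix s1 s2 l1 l2 : prefix s1 l1 -> prefix s2 l2 ->
  nested l1 l2 -> nested s1 s2.
Proof.
move=> p1 p2 /orP[p|p].
  by apply: prefix_nested p2; exact: prefix_trans p1 p.
by apply: prefix_nested p1 _; exact: prefix_trans p2 p.
Qed.

Lemma prefix_rconsE s l x : prefix s (rcons l x) -> s = rcons l x \/ prefix s l.
Proof.
case/prefixP=> s'; case/lastP: s' => [|s' y].
  by rewrite cats0 => ->; left.
by rewrite -rcons_cat => /rcons_inj[-> _]; right; exact: prefix_prefix.
Qed.

Lemma In_mem (x : T) s : List.In x s <-> x \in s.
Proof.
elim: s => //= y s IH; rewrite in_cons; split=> [[->|/IH->]|/orP[/eqP->|/IH]].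
- by rewrite eqxx.
- by rewrite orbT.
- by left.
- by right.
Qed.

Lemma delivers_withoutP (x y : T) l :
  delivers_without x y l <-> exists l1 l2, l = l1 ++ x :: l2 /\ y \notin l1.
Proof.
split=> -[l1 [l2 [-> nin]]]; exists l1, l2; split=> //.
  by apply/negP => /In_mem.
by move/In_mem; exact/negP.
Qed.

Lemma delivers_without_prefix (x y : T) s l :
  delivers_without x y s -> prefix s l -> delivers_without x y l.
Proof.
move=> [l1 [l2 [-> nin]]] /prefixP[l3 ->].
by exists l1, (l2 ++ l3); rewrite -catA.
Qed.

(** The two decompositions are compared head by head: if [a1] ends first, [x] lies in [b1]; if [b1]
    does, [y] lies in [a1]; if both end together, [x = y]. *)
Lemma delivers_without_asym (x y : T) l :
  x <> y -> delivers_without x y l -> ~ delivers_without y x l.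
Proof.
move=> ne /delivers_withoutP[a1 [a2 [-> na]]] /delivers_withoutP[b1 [b2 [e nb]]].
elim: a1 b1 na nb e => [|a a1 IH] [|b b1] /=.
- by move=> _ _ [/ne].
- by move=> _; rewrite in_cons => /norP[/eqP xb _] [/xb].
- by rewrite in_cons => /norP[/eqP ya _] _ [/esym/ya].
- by rewrite !in_cons => /norP[_ na] /norP[_ nb] [_ ]; exact: IH.
Qed.

Lemma nested_order (x y : T) l1 l2 : x <> y -> nested l1 l2 ->
  delivers_without x y l1 -> ~ delivers_without y x l2.
Proof.
move=> ne /orP[] p d1 d2.
  exact: (delivers_without_asym ne (delivers_without_prefix d1 p)).
exact: (delivers_without_asym ne d1 (delivers_without_prefix d2 p)).
Qed.

End Nested.

Lemma prefix_map (T U : eqType) (h : T -> U) s1 s2 :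
  prefix s1 s2 -> prefix (map h s1) (map h s2).
Proof. by case/prefixP=> s ->; rewrite map_cat prefix_prefix. Qed.

Lemma nested_map_inj (T U : eqType) (h : T -> U) s1 s2 :
  injective h -> nested (map h s1) (map h s2) -> nested s1 s2.
Proof.
move=> hI; rewrite /nested !prefixE !size_map -!map_take.
by rewrite !(inj_eq (inj_map hI)).
Qed.

Section Protocol.
Variable E : environment.
Local Notation key := (@key E).
Local Notation stobmsg := (@stobmsg E).
Local Notation leaf := (@leaf E).
Local Notation broker := (broker E).
Local Notation server := (@server E).
Local Notation gstate := (gstate E).
Implicit Types (l : seq stobmsg) (ks : seq key) (b : broker) (G : gstate).

(** * Keys accepted from the STOB log *)

Definition nkeys b ks := count (fun k => k.1.2 == b) ks.

(** Replays [server_stob_deliver] without a server state: the expected number of a broker is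
    recovered as one plus the number of its keys accepted so far. *)
Definition push_key ks (x : stobmsg) : seq key :=
  let: (b, r, W) := x in
  let k := (r, b, (nkeys b ks).+1) in
  if certifies W (SWitness k) then rcons ks k else ks.

Definition keys_of l := foldl push_key [::] l.

Lemma keys_of_rcons l x : keys_of (rcons l x) = push_key (keys_of l) x.
Proof. by rewrite /keys_of -cats1 foldl_cat. Qed.

Lemma prefix_push ks x : prefix ks (push_key ks x).
Proof. by case: x => -[b r] W /=; case: ifP => _;
  rewrite ?prefix_rcons ?prefix_refl.
Qed.

Lemma keys_of_prefix l1 l2 : prefix l1 l2 -> prefix (keys_of l1) (keys_of l2).
Proof.
case/prefixP=> l ->; elim/last_ind: l => [|l x IH].
  by rewrite cats0 prefix_refl.
by rewrite -rcons_cat keys_of_rcons (prefix_trans IH) // prefix_push.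
Qed.

Lemma nkeys_prefix b ks1 ks2 : prefix ks1 ks2 -> nkeys b ks1 <= nkeys b ks2.
Proof. by case/prefixP=> ks ->; rewrite /nkeys count_cat leq_addr. Qed.

Lemma nkeys_rcons b ks k : nkeys b (rcons ks k) = nkeys b ks + (k.1.2 == b).
Proof. by rewrite /nkeys -cats1 count_cat /= addn0. Qed.

(* Every certified message found in a prefix of [l] has a number already used
   up in that prefix: none arrived before its turn, when it would have been
   ignored and a later copy of it could still be accepted. *)
Definition timely l := forall l1, prefix l1 l -> forall b r W n,
  (b, r, W) \in l1 -> certifies W (SWitness (r, b, n)) ->
  n <= nkeys b (keys_of l1).

Lemma timely_prefix l1 l2 : prefix l1 l2 -> timely l2 -> timely l1.
Proof. by move=> p t l p1; apply: t; exact: prefix_trans p1 p. Qed.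

(** A STOB message carries no batch number; since a multi-signature contains its statement, the
    witness alone fixes it. *)
Lemma certifies_fun (W : @msig E) s s' : certifies W s -> certifies W s' -> s = s'.
Proof. by case/andP=> /eqP<- _ /andP[/eqP<- _]. Qed.

Lemma timely_rcons l b r W : timely l ->
  (forall n, certifies W (SWitness (r, b, n)) -> n <= (nkeys b (keys_of l)).+1) ->
  timely (rcons l (b, r, W)).
Proof.
move=> tl hx l1 /prefix_rconsE[->|p]; last exact: tl.
move=> b' r' W' n; rewrite mem_rcons in_cons => /predU1P[[-> -> ->] c|h c].
  (* Either [n] is exactly the next number, and the new entry is accepted, or [n] was used up
     before. *)
  have := hx _ c; rewrite leq_eqVlt keys_of_rcons /=.
  case/orP=> [/eqP en|].
    by rewrite -en c nkeys_rcons /= eqxx addn1 en.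
  rewrite ltnS => h; apply: leq_trans h (nkeys_prefix _ _).
  exact: (prefix_push _ (b, r, W)).
apply: leq_trans (tl l (prefix_refl _) _ _ _ _ h c) _.
by apply/nkeys_prefix/keys_of_prefix/prefix_rcons.
Qed.

(** Keys are only ever appended, one per log entry, so [k] is traced back to the entry that was read
    when exactly [c] had been accepted. *)
Lemma keys_of_split c k l : prefix (rcons c k) (keys_of l) ->
  exists l1 l2 W, [/\ l = l1 ++ (k.1.2, k.1.1, W) :: l2, keys_of l1 = c,
    k.2 = (nkeys k.1.2 c).+1 & certifies W (SWitness k)].
Proof.
elim/last_ind: l => [|l x IH]; first by rewrite prefixs0; case: c.
have old : prefix (rcons c k) (keys_of l) ->
    exists l1 l2 W, [/\ rcons l x = l1 ++ (k.1.2, k.1.1, W) :: l2,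
    keys_of l1 = c, k.2 = (nkeys k.1.2 c).+1 & certifies W (SWitness k)].
  move=> /IH[l1 [l2 [W [-> ? ? ?]]]].
  by exists l1, (rcons l2 x), W; rewrite rcons_cat.
rewrite keys_of_rcons; case: x old => -[b r] W old /=.
case: ifP => [cW|_]; last exact: old.
case/prefix_rconsE; last exact: old.
case/rcons_inj=> -> ->; exists l, [::], W; split=> //=.
by rewrite cats1.
Qed.

(** If the entry were in [l], timeliness would bound [k.2] by the number of keys of its broker in
    [keys_of l], hence in [c], whereas [k.2] is one more than that. *)
Lemma timely_fresh c k l W :
  timely l -> prefix (keys_of l) c -> k.2 = (nkeys k.1.2 c).+1 ->
  certifies W (SWitness k) -> (k.1.2, k.1.1, W) \notin l.
Proof.
case: k => -[r b] n /= tl p -> cW; apply/negP => h.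
have := tl l (prefix_refl _) _ _ _ _ h cW.
by rewrite ltnNge nkeys_prefix.
Qed.

(** At a first disagreement after [c], the entries behind [k1] and [k2] are both next in turn. By
    [timely_fresh] each log reads its own entry without having read the other one, which the order
    hypothesis excludes. *)
Lemma timely_nested l1 l2 :
  timely l1 -> timely l2 ->
  (forall x y, x <> y -> delivers_without x y l1 -> ~ delivers_without y x l2) ->
  nested (keys_of l1) (keys_of l2).
Proof.
move=> t1 t2 ord; case: (boolP (nested _ _)) => //.
case/not_nested=> c [k1 [k2 [ne p1 p2]]]; exfalso.
have [a1 [a2 [W1 [e1 ka n1 c1]]]] := keys_of_split p1.
have [b1 [b2 [W2 [e2 kb n2 c2]]]] := keys_of_split p2.
have ta : timely a1 by apply: timely_prefix t1; rewrite e1 prefix_prefix.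
have tb : timely b1 by apply: timely_prefix t2; rewrite e2 prefix_prefix.
apply: (ord (k1.1.2, k1.1.1, W1) (k2.1.2, k2.1.1, W2)).
(* Equal entries would share a witness, which certifies one key only. *)
- case=> eb er eW; case/eqP: ne; move: c2; rewrite -eW => /(certifies_fun c1).
  by case.
- apply/delivers_withoutP; exists a1, a2; split=> //.
  by apply: timely_fresh n2 c2 => //; rewrite ka prefix_refl.
- apply/delivers_withoutP; exists b1, b2; split=> //.
  by apply: timely_fresh n1 c1 => //; rewrite kb prefix_refl.
Qed.

(* [A] is about to deliver [x]; a correct signer of the witness of [x] had
   reached its number with the log [B], without [x]. *)
Lemma arrives_on_time (A B : seq stobmsg) b r W :
  timely A -> timely B -> nested (keys_of A) (keys_of B) ->
  (b, r, W) \notin B ->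
  (forall y, y <> (b, r, W) -> delivers_without y (b, r, W) B ->
     ~ delivers_without (b, r, W) y (rcons A (b, r, W))) ->
  nkeys b (keys_of B) <= nkeys b (keys_of A).
Proof.
move=> tA tB /orP[|]; last by move=> p _ _; exact: nkeys_prefix.
case/prefixP=> [[|k ks]] eB xB ord; first by rewrite eB cats0.
(* Suppose [B] accepted a further key [k]. Its entry is read in [B] without [(b, r, W)], which [B]
   lacks altogether, while [A] reads [(b, r, W)] before that entry, since [k] is fresh for [A]. *)
exfalso.
have : prefix (rcons (keys_of A) k) (keys_of B).
  by rewrite eB -cat_rcons prefix_prefix.
case/keys_of_split=> b1 [b2 [V [eB' kb n c]]].
move: xB; rewrite eB' mem_cat in_cons !negb_or => /and3P[xb1 xk _].
apply: (ord (k.1.2, k.1.1, V)).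
- by move/esym/eqP; rewrite (negPf xk).
- by apply/delivers_withoutP; exists b1, b2; split.
- apply/delivers_withoutP; exists A, [::]; rewrite cats1; split=> //.
  by apply: timely_fresh n c => //; rewrite prefix_refl.
Qed.


(** * Invariants of the servers *)

(** Completion from the initial state over all leaves at once, forgetting their division into
    batches. *)
Definition run (ls : seq leaf) : completion_acc :=
  foldl complete_leaf (CAcc (fun _ => None) fmap0 [::] [::]) ls.

Lemma foldl_complete_leaf (ls : seq leaf) last exc exc' cls cls'
    (dl0 dl : seq (int * msg E)) :
  let a := foldl complete_leaf (CAcc last exc cls (dl0 ++ dl)) ls in
  let a' := foldl complete_leaf (CAcc last exc' cls' dl) ls in
  a_last a = a_last a' /\ a_delivered a = dl0 ++ a_delivered a'.
Proof.
elim: ls last exc exc' cls cls' dl => //= -[[id q] m] ls IH.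
move=> last exc exc' cls cls' dl.
rewrite /complete_leaf /=.
case: (last id) => [[q' m']|]; last by rewrite rcons_cat; exact: IH.
case: ifP => _; first exact: IH.
case: ifP => _; first exact: IH.
case: ifP => _; last exact: IH.
by rewrite rcons_cat; exact: IH.
Qed.

Lemma run_cat (ls1 ls2 : seq leaf) :
  let a := foldl complete_leaf (CAcc (a_last (run ls1)) fmap0 [::] [::]) ls2 in
  a_last (run (ls1 ++ ls2)) = a_last a /\
  a_delivered (run (ls1 ++ ls2)) = a_delivered (run ls1) ++ a_delivered a.
Proof.
rewrite /run foldl_cat -/(run ls1); case: (run ls1) => last exc cls dl /=.
(* Writing [dl] as [dl ++ [::]] lets the second fold start from no deliveries. *)
by rewrite -[in CAcc last exc cls dl](cats0 dl); exact: foldl_complete_leaf.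
Qed.

Lemma root_of_inj : injective (@root_of E).
Proof. by move=> ls1 ls2 /merkle_inj/inj_map; apply=> ? ? []. Qed.

(* The completed batches are not stored, hence [server_leaves] can only assert
   that lists of leaves with the right roots explain the state. *)
Record server_inv (s : @sstate E) : Prop := ServerInv {
  server_num : forall b, expected_num s b = (nkeys b (keys_of (stob_log s))).+1;
  server_keys : rev (completed s) ++ pool s = keys_of (stob_log s);
  server_batches : forall k bt, batches s k = Some bt -> root_of (leaves bt) = k.1.1;
  server_leaves : exists Ls,
    [/\ map (@root_of E) Ls = [seq k.1.1 | k <- rev (completed s)],
        last_of s = a_last (run (flatten Ls))
      & map snd (delivered s) = map snd (a_delivered (run (flatten Ls)))]
}.

Lemma server_inv_init d : server_inv (init_server d).
Proof. by split=> //; exists [::]. Qed.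

(** The state that fixes the order of deliveries changes only on STOB delivery and on completion; a
    received message can only affect the stored batches, expected roots, directory and accepts. *)
Lemma server_recv_frame i (s s' : @sstate E) src x o xs :
  server_recv i s src x = (s', o, xs) ->
  [/\ expected_num s' = expected_num s, completed s' = completed s,
      pool s' = pool s, stob_log s' = stob_log s
    & last_of s' = last_of s /\ delivered s' = delivered s].
Proof.
case: s => bs en er pl last c nc d co ac sl dl.
move=> recv; destruct src, x; move: recv => /=;
  repeat (case: ifP => _ || case: (bs _) => [?|]); by case=> <- _ _.
Qed.

(** A batch from a broker is stored under the root computed from it, a batch in a reply only after
    its root is checked, and collection only removes batches. *)
Lemma server_recv_batches i (s s' : @sstate E) src x o xs :
  server_recv i s src x = (s', o, xs) ->
  (forall k bt, batches s k = Some bt -> root_of (leaves bt) = k.1.1) ->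
  forall k bt, batches s' k = Some bt -> root_of (leaves bt) = k.1.1.
Proof.
case: s => bs en er pl last c nc d co ac sl dl /= recv bsP.
have updP k0 v : (forall bt, v = Some bt -> root_of (leaves bt) = k0.1.1) ->
    forall k bt, upd bs k0 v k = Some bt -> root_of (leaves bt) = k.1.1.
  by move=> vP k bt; rewrite /upd /=; case: eqP => [->|_]; [exact: vP|exact: bsP].
destruct src, x; move: recv => /=;
  repeat (case: ifP => ? || case: (bs _) => [?|]); case=> <- _ _ //=.
all: apply: updP => // bt [<-] //.
all: by match goal with h : is_true (_ && (root_of _ == _)) |- _ =>
  case/andP: h => _ /eqP end.
Qed.

Lemma server_recv_inv i (s s' : @sstate E) src x o xs :
  server_recv i s src x = (s', o, xs) -> server_inv s -> server_inv s'.
Proof.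
move=> recv [nums keys bats lvs].
have [en co pl sl [la dl]] := server_recv_frame recv.
split; rewrite ?en ?co ?pl ?sl ?la ?dl //.
exact: (server_recv_batches recv).
Qed.

Lemma server_complete_inv i (s s' : @sstate E) k pl bt o :
  pool s = k :: pl -> batches s k = Some bt ->
  server_complete i s k pl bt = (s', o) -> server_inv s -> server_inv s'.
Proof.
case: s => bs en er po last c nc d co ac sl dl /= -> bk cpl.
case=> /= nums keys bats [Ls [roots la dlv]].
case: cpl => <- _; split=> //=.
  by rewrite -keys rev_cons cat_rcons.
have [run_last run_dl] := run_cat (flatten Ls) (leaves bt).
(* The stored batch has the root of [k] by [server_batches], so its leaves may explain this
   completion. *)
exists (rcons Ls (leaves bt)); rewrite flatten_rcons rev_cons !map_rcons.
by rewrite roots (bats _ _ bk) run_last run_dl !map_cat dlv -!map_comp la.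
Qed.

Lemma server_stob_deliver_inv (s s' : @sstate E) x o :
  server_stob_deliver s x = (s', o) -> server_inv s -> server_inv s'.
Proof.
case: s => bs en er pl last c nc d co ac sl dl + [/= nums keys bats lvs].
(* With [nums], the server and [push_key] test the witness against the same key. *)
case: x => -[b r] W /=; rewrite nums.
case: ifP => cW [<- _]; split=> //=; rewrite keys_of_rcons /= cW //.
  move=> b'; rewrite nkeys_rcons /upd /= [b' == b]eq_sym.
  by case: eqP => [->|_]; rewrite ?addn1 ?addn0.
by rewrite -keys rcons_cat.
Qed.

Lemma server_complete_log i (s s' : @sstate E) k pl bt o :
  server_complete i s k pl bt = (s', o) -> stob_log s' = stob_log s.
Proof. by case: s => > [<- _]. Qed.

Lemma server_stob_deliver_log (s s' : @sstate E) x o :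
  server_stob_deliver s x = (s', o) -> stob_log s' = rcons (stob_log s) x.
Proof.
by case: s => >; case: x => -[b r] W /=; case: ifP => _ [<- _].
Qed.

(** * Signatures in transit *)

Definition num_ok (s : @sstate E) (sg : @statement E) : bool :=
  if sg is SWitness k then k.2 == expected_num s k.1.2 else true.

(** The sole signer of a shard is recorded so that its emission alone makes it derivable. *)
Definition server_out_ok i (s : @sstate E) (x : @message E) : bool :=
  match x with
  | MWitnessShard sg => (sg.2 == [:: Server i]) && num_ok s sg.1
  | MCompletionShard _ sg _ => num_ok s sg.1
  | MBatchAcquired _ _ | MRequestBatch _ | MBatchReply _ _ _ | MCollection _
  | MCollectionAccept _ => true
  | _ => false
  end.

Lemma server_out_num i s x :
  server_out_ok i s x -> all (num_ok s) (map fst (msigs x)).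
Proof. by case: x => //= [sg /andP[_ ->]|_ sg _ ->]. Qed.

(** Derivability is tracked only on the way of witness signatures to STOB: shards to brokers, then
    certificates to servers. *)
Definition msg_ok G (x : @message E) : bool :=
  match x with
  | MWitness _ _ W | MWitnessShard W => derivable G W
  | _ => true
  end.

Lemma all_to_servers (P : pred message) (x : message) :
  P x -> all (fun y => P y.2) (@to_servers E x).
Proof. by move=> Px; rewrite all_map; apply/allP. Qed.

Lemma server_recv_out G i (s s' : @sstate E) src x o xs :
  server_recv i s src x = (s', o, xs) -> msg_ok G x ->
  all (fun y => server_out_ok i s y.2) o /\
  all (fun y : stobmsg => derivable G y.2) xs.
Proof.
case: s => bs en er pl last c nc d co ac sl dl /= recv ok.
destruct src, x; move: recv => /=;
  repeat (case: ifP => [/and3P[_ ? _]|?] || case: ifP => ? || case: (bs _) => [?|]);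
  case=> _ <- <- //=.
- by rewrite eqxx; split=> //; rewrite andbT.
- by rewrite andbT.
Qed.

Lemma server_complete_out i (s s' : @sstate E) k pl bt o :
  server_complete i s k pl bt = (s', o) -> all (fun y => server_out_ok i s y.2) o.
Proof. by case: s => > [_ <-] /=; exact: all_to_servers. Qed.

Lemma server_stob_deliver_out i (s s' : @sstate E) x o :
  server_stob_deliver s x = (s', o) -> all (fun y => server_out_ok i s y.2) o.
Proof.
case: s => >; case: x => -[b r] W /=; case: ifP => _ [_ <-] //.
by case: ifP => // _; exact: all_to_servers.
Qed.

Definition witness_sig b (y : @sbatch E) : @msig E :=
  (SWitness (s_root y, b, s_num y), map Server (enum (s_witness y))).

(** The signers collected so far form a derivable multi-signature even below the threshold, so the
    certificate is derivable whenever it is sent. *)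
Definition broker_ok G b (s : @bstate E) : bool :=
  all (fun y => derivable G (witness_sig b y)) (b_sent s).

Lemma derivable_servers G st (A : {set server}) :
  derivable G (st, map Server (enum A)) =
  all (fun i => (i \in correct_server E) ==> ((Server i, st) \in signed G)) (enum A).
Proof. by rewrite /derivable /= all_map. Qed.

Lemma all_pmap (T U : Type) (h : T -> option U) (P : pred U) s :
  all (fun x => oapp P true (h x)) s -> all P (pmap h s).
Proof.
by elim: s => //= x s IH /andP[]; case: (h x) => [y|] //= -> /IH.
Qed.

Lemma all_flatten (T : Type) (P : pred T) ss :
  all P (flatten ss) = all (all P) ss.
Proof. by elim: ss => //= s ss IH; rewrite all_cat IH. Qed.

Lemma update_sent_ok (P : pred (@sbatch E)) (Q : pred (@proc E * @message E))
    (s s' : @bstate E) p g o :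
  update_sent s p g = (s', o) ->
  (forall y, p y -> P y -> P (g y).1 && all Q (g y).2) ->
  all P (b_sent s) -> all P (b_sent s') /\ all Q o.
Proof.
case: s => num d q po op sn lst /= [<- <-] gP /=.
elim: sn => //= y sn IH /andP[Py /IH[-> Qo]]; rewrite all_cat Qo.
by case: ifP => [/gP/(_ Py)/andP[-> ->]|_]; rewrite ?Py.
Qed.

Lemma on_witness_shard_ok G b i (y : @sbatch E) :
  derivable G (SWitness (s_root y, b, s_num y), [:: Server i]) ->
  derivable G (witness_sig b y) ->
  derivable G (witness_sig b (on_witness_shard b i y).1) &&
  all (fun z => msg_ok G z.2) (on_witness_shard b i y).2.
Proof.
case: y => num r bt o w sh dn; rewrite /witness_sig /= => iok wok.
have ok : derivable G (SWitness (r, b, num), map Server (enum (i |: w))).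
  rewrite derivable_servers; apply/allP => j; rewrite mem_enum in_setU1.
  case/predU1P=> [->|jw]; first by case/andP: iok.
  by move: wok; rewrite derivable_servers => /allP; apply; rewrite mem_enum.
by rewrite ok; case: ifP => // _; exact: all_to_servers.
Qed.

Lemma on_completion_shard_ok G b d i rc n exc (y : @sbatch E) :
  derivable G (witness_sig b y) ->
  derivable G (witness_sig b (on_completion_shard d i rc n exc y).1) &&
  all (fun z => msg_ok G z.2) (on_completion_shard d i rc n exc y).2.
Proof.
case: y => num r bt o w sh dn; rewrite /= => ok.
case: ifP => _ /=; first by rewrite ok.
case: ifP => _ /=; rewrite ok //=.
apply/all_pmap; apply/(all_nthP None) => k _.
by case: (nth _ _ _) => [[[id q] m]|] //=; case: (d id).
Qed.

Lemma broker_recv_ok G b (s s' : @bstate E) src x o :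
  broker_recv b s src x = (s', o) -> msg_ok G x -> broker_ok G b s ->
  broker_ok G b s' /\ all (fun y => msg_ok G y.2) o.
Proof.
case: s => num d q po op sn lst recv xok ok.
destruct src as [c|c|i], x as [a m k sg ev| | | |r us| |sg| |
  [[r b'] num'] [[m q'|r'|k|rc n] ps] exc| | | | |];
  move: recv; rewrite /broker_recv; try by case=> <- <-.
- by case: ifP => _ [<- <-].
- move=> [<- <-]; split=> //; by elim: (filter _ _).
- move=> upd; apply: (update_sent_ok (P := fun y => derivable G (witness_sig b y))
    (Q := fun y => msg_ok G y.2) upd _ ok) => y /eqP sgy yok.
  by apply: on_witness_shard_ok => //; rewrite -sgy.
- move=> upd; apply: (update_sent_ok (P := fun y => derivable G (witness_sig b y))
    (Q := fun y => msg_ok G y.2) upd _ ok) => y _ yok.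
  exact: on_completion_shard_ok.
Qed.

Lemma broker_flush_ok G b (s s' : @bstate E) o :
  broker_flush s = (s', o) -> broker_ok G b s ->
  broker_ok G b s' /\ all (fun y => msg_ok G y.2) o.
Proof.
case: s => num d q us op sn lst [<- <-] ok; split=> //.
by rewrite all_map; elim: us {ok}.
Qed.

Lemma broker_close_ok G b (s s' : @bstate E) op1 ob op2 o :
  broker_close b s op1 ob op2 = (s', o) -> broker_ok G b s ->
  broker_ok G b s' /\ all (fun y => msg_ok G y.2) o.
Proof.
case: s => num d q us op sn lst [<- <-] ok; split; last exact: all_to_servers.
rewrite /broker_ok /= all_rcons.
rewrite -/(broker_ok G b (BState num d q us op sn lst)) ok andbT.
(* A new batch has no signers yet, so nothing is to be checked. *)
by rewrite /witness_sig derivable_servers /= enum_set0.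
Qed.

Lemma client_submit_ok G c (s s' : @cstate E) m b o :
  client_submit c s m b = (s', o) -> all (fun y => msg_ok G y.2) o.
Proof. by case: s => > [_ <-]. Qed.

Lemma client_broadcast_ok G c (s s' : @cstate E) m b o :
  client_broadcast c s m b = (s', o) -> all (fun y => msg_ok G y.2) o.
Proof. by case: s => >; exact: client_submit_ok. Qed.

Lemma client_recv_ok G c (s s' : @cstate E) src x o :
  client_recv c s src x = (s', o) -> all (fun y => msg_ok G y.2) o.
Proof.
case: s => sn ev lst pend tried used tm recv.
destruct src, x; move: recv => /=; try by case=> _ <-.
  by case: o0 => [e|]; [case: ifP => _|]; case=> _ <-.
by case: ifP => _; [case: ifP => _|]; case=> _ <-.
Qed.

(** * The global invariant and its preservation *)

Record global_inv G : Prop := GlobalInv {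
  net_ok : all (fun y => msg_ok G y.2) (net G);
  stob_ok : all (fun y : server * stobmsg => derivable G y.2.2) (stob_sent G);
  brokers_ok : forall b, correct_broker b -> broker_ok G b (brokers G b);
  servers_ok : forall i, server_inv (servers G i)
}.

Lemma global_inv_initial G : initial G -> global_inv G.
Proof.
case=> _ bi si [n _ t]; split; rewrite ?n ?t //.
- by move=> b _; have [d _ ->] := bi b.
- by move=> i; have [d _ ->] := si i; exact: server_inv_init.
Qed.

Section Monotonicity.
Variables G G' : gstate.
Hypothesis sub : {subset signed G <= signed G'}.

(** Signatures are never withdrawn, and [signed] occurs only in the conclusion of the implication in
    [derivable]. *)
Lemma derivable_mono sg : derivable G sg -> derivable G' sg.
Proof. by apply: sub_all => p /implyP h; apply/implyP => /h/sub. Qed.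

Lemma msg_ok_mono x : msg_ok G x -> msg_ok G' x.
Proof. by case: x => // *; exact: derivable_mono. Qed.

Lemma broker_ok_mono b s : broker_ok G b s -> broker_ok G' b s.
Proof. by apply: sub_all => y; exact: derivable_mono. Qed.

End Monotonicity.

Lemma signed_emit p o G : {subset signed G <= signed (emit p o G)}.
Proof. by move=> x h; rewrite mem_cat h. Qed.

Lemma msigs_emitted p o G :
  all (fun y => all (fun sg => (p \in sg.2) ==> ((p, sg.1) \in signed (emit p o G)))
    (msigs y.2)) o.
Proof.
suff : all (fun sg => (p \in sg.2) ==> ((p, sg.1) \in signed (emit p o G)))
    (flatten [seq msigs y.2 | y <- o]) by rewrite all_flatten all_map.
apply/allP => sg sgo; apply/implyP => psg.
rewrite mem_cat; apply/orP; right.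
by apply: (map_f (fun sg => (p, sg.1))); rewrite mem_filter psg.
Qed.

Lemma server_out_msg_ok i s o G :
  all (fun y => server_out_ok i s y.2) o ->
  all (fun y => msg_ok (emit (Server i) o G) y.2) o.
Proof.
move=> out; have : all (predI (fun y => server_out_ok i s y.2)
    (fun y => all (fun sg => (Server i \in sg.2) ==>
       ((Server i, sg.1) \in signed (emit (Server i) o G))) (msigs y.2))) o.
  by rewrite all_predI out msigs_emitted.
apply: sub_all => -[q x] /= /andP[]; case: x => //= sg.
case/andP=> /eqP e _; rewrite /derivable e /= inE eqxx /= !andbT => ->.
by rewrite implybT.
Qed.

Lemma emit_inv p o G :
  global_inv G -> all (fun y => msg_ok (emit p o G) y.2) o ->
  global_inv (emit p o G).
Proof.
case=> nok sok bok srv ook; have sub := @signed_emit p o G.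
split=> //=.
- rewrite all_cat all_map ook andbT.
  by apply: sub_all nok => y; exact: msg_ok_mono.
- by apply: sub_all sok => y; exact: derivable_mono.
- by move=> b /bok; exact: broker_ok_mono.
Qed.

Lemma stob_emit_inv i xs G :
  global_inv G -> all (fun y : stobmsg => derivable G y.2) xs ->
  global_inv (stob_emit i xs G).
Proof. by case=> nok sok bok srv xok; split=> //=; rewrite all_cat all_map sok. Qed.

Lemma set_net_inv n1 n2 y G : net G = n1 ++ y :: n2 ->
  global_inv G -> global_inv (set_net (n1 ++ n2) G) /\ msg_ok G y.2.
Proof.
move=> en [nok sok bok srv]; move: nok; rewrite en all_cat /= => /and3P[n1k yk n2k].
by split=> //; split=> //=; rewrite all_cat n1k.
Qed.

Lemma set_client_inv c s G : global_inv G -> global_inv (set_client c s G).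
Proof. by case. Qed.

Lemma set_broker_inv b s G :
  broker_ok G b s -> global_inv G -> global_inv (set_broker b s G).
Proof.
move=> ok [nok sok bok srv]; split=> //= b'.
by rewrite /upd /=; case: eqP => [->|_]; [|exact: bok].
Qed.

Lemma set_server_inv i s G :
  server_inv s -> global_inv G -> global_inv (set_server i s G).
Proof.
move=> ok [nok sok bok srv]; split=> //= j.
by rewrite /upd /=; case: eqP.
Qed.

Lemma derivable_msg_ok G x : all (derivable G) (msigs x) -> msg_ok G x.
Proof. by case: x => //= [sg|r n W] /andP[]. Qed.

Lemma step_inv lb G G' : step lb G G' -> global_inv G -> global_inv G'.
Proof.
case=> {lb G G'}.
- by [].
- by move=> G n1 n2 src dst x _ en /(set_net_inv en)[].
- move=> G n1 n2 src c x s o _ en recv /(set_net_inv en)[inv _].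
  by apply: emit_inv (client_recv_ok _ recv); exact: set_client_inv.
- move=> G n1 n2 src b x s o cb en recv inv.
  have [inv' xok] := set_net_inv en inv.
  have [sok ook] := broker_recv_ok recv xok (brokers_ok inv cb).
  apply: emit_inv; first exact: set_broker_inv.
  by apply: sub_all ook => y; apply: msg_ok_mono; exact: signed_emit.
- move=> G n1 n2 src i x s o xs ci en recv inv.
  have [inv' xok] := set_net_inv en inv.
  have [ook xsok] := server_recv_out recv xok.
  apply: stob_emit_inv.
    apply: emit_inv (server_out_msg_ok _ ook).
    by apply: set_server_inv => //; exact: server_recv_inv recv (servers_ok inv i).
  by apply: sub_all xsok => y; apply: derivable_mono; exact: signed_emit.
- move=> G c m b s o _ _ brd inv.
  by apply: emit_inv (client_broadcast_ok _ brd); exact: set_client_inv.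
- move=> G c m b s o _ _ _ _ sub inv.
  by apply: emit_inv (client_submit_ok _ sub); exact: set_client_inv.
- by move=> G c m _ _ _ inv; exact: set_client_inv.
- move=> G b id u us cb _ _ inv; apply: set_broker_inv => //.
  by have := brokers_ok inv cb; case: (brokers G b).
- move=> G b s o cb _ flush inv.
  have [sok ook] := broker_flush_ok flush (brokers_ok inv cb).
  apply: emit_inv; first exact: set_broker_inv.
  by apply: sub_all ook => y; apply: msg_ok_mono; exact: signed_emit.
- move=> G b op1 ob op2 s o cb _ _ close inv.
  have [sok ook] := broker_close_ok close (brokers_ok inv cb).
  apply: emit_inv; first exact: set_broker_inv.
  by apply: sub_all ook => y; apply: msg_ok_mono; exact: signed_emit.
- move=> G i k pl bt s o ci pk bk cpl inv.
  apply: emit_inv (server_out_msg_ok _ (server_complete_out cpl)).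
  apply: set_server_inv => //.
  exact: server_complete_inv pk bk cpl (servers_ok inv i).
- move=> G i x s o ci dlv inv.
  apply: emit_inv (server_out_msg_ok _ (server_stob_deliver_out i dlv)).
  apply: set_server_inv => //.
  exact: server_stob_deliver_inv dlv (servers_ok inv i).
(* Unforgeability: a faulty source sends only what was derivable beforehand. *)
- move=> G src dst x _ xok inv; apply: emit_inv => //=; rewrite andbT.
  apply: (@msg_ok_mono G); first exact: signed_emit.
  exact: derivable_msg_ok.
- move=> G i x _ xok inv; apply: stob_emit_inv => //=.
  by rewrite andbT.
Qed.

(** * When a correct server signs a witness *)

Lemma signed_emit_inv p o G q st : (q, st) \in signed (emit p o G) ->
  (q, st) \notin signed G ->
  q = p /\ has (pred1 st) (flatten [seq map fst (msigs y.2) | y <- o]).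
Proof.
rewrite mem_cat => /orP[->//|/mapP[sg]].
rewrite mem_filter => /andP[psg sgo] [-> ->] _; split=> //.
rewrite has_pred1; suff -> : flatten [seq map fst (msigs y.2) | y <- o] =
  map fst (flatten [seq msigs y.2 | y <- o]) by exact: map_f.
by rewrite map_flatten -map_comp.
Qed.

Lemma server_signs i s o G k :
  all (fun y => server_out_ok i s y.2) o ->
  (Server i, SWitness k) \in signed (emit (Server i) o G) ->
  (Server i, SWitness k) \notin signed G ->
  k.2 = expected_num s k.1.2.
Proof.
move=> out h /(signed_emit_inv h)[_].
have : all (num_ok s) (flatten [seq map fst (msigs y.2) | y <- o]).
  by rewrite all_flatten all_map; apply: sub_all out => y; exact: server_out_num.
by move/allP => nums /hasP[st /nums + /eqP est]; rewrite est => /eqP.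
Qed.

(** An emission adds signatures of its sender only, so a new one of [Server i] comes from its own
    step, where a shard requires the number to be the expected one. *)
Lemma step_signs lb G G' i k : step lb G G' -> i \in correct_server E ->
  global_inv G ->
  (Server i, SWitness k) \in signed G' -> (Server i, SWitness k) \notin signed G ->
  k.2 = expected_num (servers G i) k.1.2.
Proof.
(* [kept] settles the steps that leave [signed] unchanged. *)
move=> stp ci inv; have kept : signed G' = signed G ->
    (Server i, SWitness k) \in signed G' -> (Server i, SWitness k) \notin signed G ->
    k.2 = expected_num (servers G i) k.1.2 by move=> -> ->.
case: stp inv kept => {lb G G'}.
- by move=> G _; apply.
- by move=> G n1 n2 src dst x _ _ _; apply.
- by move=> G n1 n2 src c x s o _ _ _ _ _ /signed_emit_inv sg /sg[].
- by move=> G n1 n2 src b x s o _ _ _ _ _ /signed_emit_inv sg /sg[].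
- move=> G n1 n2 src j x s o xs _ en recv inv _ sg nsg.
  have [[ij] _] := signed_emit_inv sg nsg; move: sg nsg; rewrite -{}ij in recv en *.
  have [_ xok] := set_net_inv en inv; have [ook _] := server_recv_out recv xok.
  exact: server_signs ook.
- by move=> G c m b s o _ _ _ _ _ /signed_emit_inv sg /sg[].
- by move=> G c m b s o _ _ _ _ _ _ _ /signed_emit_inv sg /sg[].
- by move=> G c m _ _ _ _; apply.
- by move=> G b id u us _ _ _ _; apply.
- by move=> G b s o _ _ _ _ _ /signed_emit_inv sg /sg[].
- by move=> G b op1 ob op2 s o _ _ _ _ _ _ /signed_emit_inv sg /sg[].
- move=> G j q pl bt s o _ _ _ cpl _ _ sg nsg.
  have [[ij] _] := signed_emit_inv sg nsg; move: sg nsg; rewrite -{}ij in cpl *.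
  exact: server_signs (server_complete_out cpl).
- move=> G j x s o _ dlv _ _ sg nsg.
  have [[ij] _] := signed_emit_inv sg nsg; move: sg nsg; rewrite -{}ij in dlv *.
  exact: server_signs (server_stob_deliver_out i dlv).
- move=> G src dst x ncs _ _ _ sg nsg; have [e _] := signed_emit_inv sg nsg.
  by move: ncs; rewrite -e /= ci.
- by move=> G j x _ _ _; apply.
Qed.

(** * Executions *)

Lemma step_log lb G G' : step lb G G' ->
  (forall j, stob_log (servers G' j) = stob_log (servers G j)) \/
  exists i x, [/\ i \in correct_server E,
    stob_log (servers G' i) = rcons (stob_log (servers G i)) x &
    forall j, j != i -> stob_log (servers G' j) = stob_log (servers G j)].
Proof.
have frame H i s : stob_log s = stob_log (servers H i) ->
    forall j, stob_log (upd (servers H) i s j) = stob_log (servers H j).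
  by move=> e j; rewrite /upd /=; case: eqP => // ->.
case=> {lb G G'}; try by left.
- move=> G n1 n2 src i x s o xs _ _ recv; left; apply: frame.
  by have [_ _ _ -> _] := server_recv_frame recv.
- by move=> G i k pl bt s o _ _ _ cpl; left; apply: frame (server_complete_log cpl).
- move=> G i x s o ci dlv; right; exists i, x; split=> //=.
    by rewrite /upd /= eqxx (server_stob_deliver_log dlv).
  by move=> j ne; rewrite /upd /= (negPf ne).
Qed.

(** More than [f] signers cannot all be among the at most [f] faulty servers. *)
Lemma certifies_correct (W : @msig E) st : certifies W st ->
  exists2 i, i \in correct_server E & Server i \in W.2.
Proof.
case/andP=> _ big; set A := [set i | Server i \in W.2] in big.
case: (boolP (A \subset ~: correct_server E)) => [/subset_leq_card le|].
  by have := leq_trans big (leq_trans le (few_faulty_servers E)); rewrite ltnn.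
case/subsetPn=> i; rewrite inE => iW; rewrite inE negbK => ci.
by exists i.
Qed.

Section Execution.
Variables (lab : nat -> label E) (st : nat -> gstate).
Hypotheses (ex : execution lab st) (stob : stob_properties st).
Local Notation log t i := (stob_log (servers (st t) i)).

Lemma exec_inv t : global_inv (st t).
Proof.
elim: t => [|t IH]; first exact: global_inv_initial (exec_initial ex).
exact: step_inv (exec_step ex t) IH.
Qed.

(** Going back to the step that added the signature, which exists because none is present initially,
    gives a time when the number was expected and the witness could not yet exist. *)
Lemma first_signature t i k : i \in correct_server E ->
  (Server i, SWitness k) \in signed (st t) ->
  exists t0, [/\ t0 < t, (Server i, SWitness k) \notin signed (st t0)
    & k.2 = expected_num (servers (st t0) i) k.1.2].
Proof.
move=> ci; elim: t => [|t IH].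
  by case: (exec_initial ex) => _ _ _ [_ -> _].
case: (boolP ((Server i, SWitness k) \in signed (st t))) => [|nsg sg].
  case/IH=> t0 [lt ? ?] _.
  by exists t0; split=> //; exact: ltnW.
by exists t; split=> //; exact: step_signs (exec_step ex t) ci (exec_inv t) sg nsg.
Qed.

Lemma log_derivable t i x : i \in correct_server E -> x \in log t i ->
  derivable (st t) x.2.
Proof.
move=> ci /(stob_integrity stob ci)[j sent].
exact: (allP (stob_ok (exec_inv t)) _ sent).
Qed.

Lemma log_number t i b :
  expected_num (servers (st t) i) b = (nkeys b (keys_of (log t i))).+1.
Proof. exact: server_num (servers_ok (exec_inv t) i) b. Qed.

Lemma logs_ordered i j t t' x y :
  i \in correct_server E -> j \in correct_server E -> x <> y ->
  delivers_without x y (log t i) -> ~ delivers_without y x (log t' j).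
Proof.
move=> ci cj ne d d'; apply: (stob_total_order stob ne ci _ cj); first by exists t.
by exists t'.
Qed.

(** Strong induction on time, for all correct servers together: a new entry of one log is justified
    by an earlier log of another server that signed its witness. *)
Lemma logs_timely t i : i \in correct_server E -> timely (log t i).
Proof.
move=> ci; elim/ltn_ind: t i ci => -[_ i ci|t IH i ci].
  have [d _ ->] : exists2 d, sound d & servers (st 0) i = init_server d.
    by case: (exec_initial ex).
  by move=> l; rewrite prefixs0 => /eqP->.
case: (step_log (exec_step ex t)) => [same|[i' [x [ci' logx same]]]].
  by rewrite same; exact: IH.
have [e|/same->] := eqVneq i i'; last exact: IH.
move: e ci' logx => <- _; case: x => -[b r] W logx.
rewrite logx; apply: timely_rcons; first exact: IH.
move=> n cW; have [k0 ck0 k0W] := certifies_correct cW.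
have W1 : W.1 = SWitness (r, b, n) by case/andP: cW => /eqP.
(* No correct server has the entry in its log before [k0] signs; at [t0] this shows that the log of
   [k0] lacks it. *)
have xder t' k : k \in correct_server E -> (b, r, W) \in log t' k ->
    (Server k0, SWitness (r, b, n)) \in signed (st t').
  move=> ck /(log_derivable ck)/allP/(_ _ k0W)/implyP; rewrite /= W1; exact.
have /(first_signature ck0)[t0 [lt0 unsigned]] :
    (Server k0, SWitness (r, b, n)) \in signed (st t.+1).
  by apply: (xder _ i ci); rewrite logx mem_rcons mem_head.
(* [n] is one more than the number of keys of [b] accepted by [k0] at [t0], so it remains to compare
   that number with the one of [i] at [t]. *)
rewrite log_number /= => ->; rewrite ltnS.
have tA := IH t (ltnSn t) i ci; have tB := IH t0 lt0 k0 ck0.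
apply: (arrives_on_time tA tB).
- by apply: (timely_nested tA tB) => x y; exact: logs_ordered.
- by apply/negP => /(xder _ _ ck0); apply/negP.
- by move=> y ne; rewrite -logx; exact: logs_ordered.
Qed.

(** Comparability is passed along from accepted keys to completed keys, their roots, the leaves by
    injectivity of [root_of], and finally the delivered messages, because [run] only appends
    deliveries. *)
Lemma deliveries_nested t t' i j :
  i \in correct_server E -> j \in correct_server E ->
  nested (delivered_messages st t i) (delivered_messages st t' j).
Proof.
move=> ci cj.
have [_ keysi _ [Li [rooti _ dli]]] := servers_ok (exec_inv t) i.
have [_ keysj _ [Lj [rootj _ dlj]]] := servers_ok (exec_inv t') j.
have cmp : nested (rev (completed (servers (st t) i)))
    (rev (completed (servers (st t') j))).
  apply: (@nested_prefix _ _ _ (keys_of (log t i)) (keys_of (log t' j))).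
  - by rewrite -keysi prefix_prefix.
  - by rewrite -keysj prefix_prefix.
  - apply: timely_nested; try exact: logs_timely.
    by move=> x y; exact: logs_ordered.
have {}cmp : nested Li Lj.
  apply: (nested_map_inj root_of_inj); rewrite rooti rootj.
  by case/orP: cmp => p; apply/orP; [left|right]; exact: prefix_map.
have mono (L L' : seq (seq leaf)) : prefix L L' ->
    prefix (map snd (a_delivered (run (flatten L))))
           (map snd (a_delivered (run (flatten L')))).
  case/prefixP=> M ->; rewrite flatten_cat.
  have [_ ->] := run_cat (flatten L) (flatten M).
  by rewrite map_cat prefix_prefix.
rewrite /delivered_messages dli dlj.
by case/orP: cmp => /mono p; apply/orP; [left|right].
Qed.

End Execution.
End Protocol.

Theorem theorem4 (E : environment) (lab : nat -> label E) (st : nat -> gstate E) :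
  execution lab st -> stob_properties st ->
  total_order (fun i => i \in correct_server E) (delivered_messages st).
Proof.
move=> ex stob m m' ne i ci [t d] j cj [t' d'].
exact: (nested_order ne (deliveries_nested ex stob t t' ci cj) d d').
Qed.
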